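(* Let $(\Delta_K,\Delta_G,\Delta_H)$ be a Zappa–Szép Garside structure for the Zappa–Szép product $K=G\bowtie H$, and let $g_1,g_2\in\mathcal D_G$ and $h_1,h_2\in\mathcal D_H$. Then one has $\partial_K(g_1\vee h_1)\wedge(g_2\vee h_2)=\mathbf 1$ if and only if $\partial_G(h_1^{-1}\triangleright g_1)\wedge g_2=\mathbf 1$ and $\partial_H(g_1^{-1}\blacktriangleright h_1)\wedge h_2=\mathbf 1$. If, moreover, $g_2\neq\mathbf 1$ and $h_2\neq\mathbf 1$, then one has $(g_1\vee h_1)\,|\,(g_2\vee h_2)$ if and only if $(h_1^{-1}\triangleright g_1)\,|\,g_2$ and $(g_1^{-1}\blacktriangleright h_1)\,|\,h_2$.
   Context: Zappa–Szép product: for a monoid $K$ with submonoids $G,H$, write $K=G\bowtie H$ if for every $k\in K$ there exist unique $g_1,g_2\in G$ and $h_1,h_2\in H$ such that $g_1h_1=k=h_2g_2$. Actions: for $g\in G$, $h\in H$ the elements $h\triangleright g\in G$, $h\triangleleft g\in H$, $g\blacktriangleright h\in H$, $g\blacktriangleleft h\in G$ are defined by $hg=(h\triangleright g)(h\triangleleft g)$ and $gh=(g\blacktriangleright h)(g\blacktriangleleft h)$. If $K$ is a Garside monoid, the maps $x\mapsto h\triangleright x$ on $G$ and $y\mapsto g\blacktriangleright y$ on $H$ are bijections, and $x\mapsto h^{-1}\triangleright x$ and $y\mapsto g^{-1}\blacktriangleright y$ denote their inverses ($h^{-1}$, $g^{-1}$ are purely notational). Garside monoids: in a monoid $M$ with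 identity $\mathbf 1$, write $x\preccurlyeq y$ ($x$ is a prefix of $y$) if $y=xu$ for some $u\in M$, and $y\succcurlyeq x$ ($x$ is a suffix of $y$) if $y=ux$ for some $u\in M$. An atom is an element $a\neq\mathbf 1$ such that $a=uv$ implies $u=\mathbf 1$ or $v=\mathbf 1$. $M$ is atomic if it is generated by its atoms and for each $x\in M$ there is an upper bound on the lengths of decompositions of $x$ as a product of atoms. An element is balanced if its set of prefixes equals its set of suffixes; this common set is denoted $\mathrm{Div}(d)$. A Garside structure is a pair $(M,\Delta)$ where $M$ is a cancellative atomic monoid, the prefix and suffix relations are lattice orders, $\Delta\in M$ is balanced, $M$ is generated by $\mathrm{Div}(\Delta)$, and $\mathrm{Div}(\Delta)$ is finite. $M$ is a Garside monoid if such a $\Delta$ (a Garside element) exists. Zappa–Szép Garside structure: $(\Delta_K,\Delta_G,\Delta_H)$ is one for $K=G\bowtie H$ if $K$ is a Garside monoid (it then follows that $G$ and $H$ are Garside monoids), $\Delta_K,\Delta_G,\Delta_H$ are Garside elements of $K,G,H$ respectively, and $\Delta_K=\Delta_G\Delta_H$. Notation: for $M\in\{K,G,H\}$, $\mathcal D_M=\mathrm{Div}(\Delta_M)$, and for $x\in\mathcal D_M$, $\partial_Mx\in\mathcal D_M$ is the unique element with $x\,\partial_Mx=\Delta_M$. $\vee$ and $\wedge$ are join and meet for the prefix order ($g_i\vee h_i$ is taken in $K$). For $s_1,s_2\in\mathcal D_M$, $s_1|s_2$ (the word $s_1.s_2$ is in left normal form in $M$) means $s_1,s_2\ne\mathbf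 1$ and $\partial_Ms_1\wedge s_2=\mathbf 1$. *)

(* Defs.v *)
From mathcomp Require Import all_boot.
From mathcomp Require Import boolp classical_sets cardinality.

Set Implicit Arguments.
Unset Strict Implicit.
Unset Printing Implicit Defensive.

Local Open Scope classical_set_scope.
Local Open Scope group_scope.

(* Submonoids of an ambient monoid K are given by their carriers, and every
   notion below is intrinsic to the submonoid M: the cofactors, bounds, factors
   and so on range over M only.  K itself is the case M = [set: K]. *)
Section Garside.
Variables (K : monoidType) (M : set K).
Implicit Types (a d s u v w x y z : K) (S : set K) (le : K -> K -> Prop).

Definition is_prefix x y := exists2 u, M u & y = x * u.
Definition is_suffix x y := exists2 u, M u & y = u * x.

Definition is_atom a :=
  [/\ M a, a <> 1 & forall u v, M u -> M v -> a = u * v -> u = 1 \/ v = 1].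

Definition is_word S (w : seq K) := forall a, a \in w -> S a.

Definition generated_by S :=
  forall x, M x -> exists2 w : seq K, is_word S w & x = \prod_(a <- w) a.

Definition atomic :=
  generated_by is_atom /\
  forall x, M x -> exists n : nat, forall w : seq K,
    is_word is_atom w -> x = \prod_(a <- w) a -> (size w <= n)%N.

Definition cancellative :=
  forall x y z, M x -> M y -> M z ->
    (x * y = x * z -> y = z) /\ (y * x = z * x -> y = z).

Definition is_join le x y z :=
  [/\ M z, le x z, le y z & forall w, M w -> le x w -> le y w -> le z w].
Definition is_meet le x y z :=
  [/\ M z, le z x, le z y & forall w, M w -> le w x -> le w y -> le w z].

Definition lattice_order le :=
  [/\ forall x, M x -> le x x,
      forall x y, M x -> M y -> le x y -> le y x -> x = y,
      forall x y z, M x -> M y -> M z -> le x y -> le y z -> le x z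
    & forall x y, M x -> M y ->
        (exists z, is_join le x y z) /\ (exists z, is_meet le x y z)].

Definition prefixes d := [set x | M x /\ is_prefix x d].
Definition suffixes d := [set x | M x /\ is_suffix x d].

Definition balanced d := prefixes d = suffixes d.

(* Only meaningful for balanced d. *)
Definition Div d := prefixes d.

Definition garside_structure d :=
  [/\ cancellative, atomic, lattice_order is_prefix & lattice_order is_suffix]
  /\ [/\ M d, balanced d, generated_by (Div d) & finite_set (Div d)].

Definition garside_monoid := exists d, garside_structure d.

(* Here and below, [xget 1 P] is an element satisfying P whenever there is one
   (the unique one, in all intended uses), and the junk value 1 otherwise. *)
Definition join x y : K := xget 1 [set z | is_join is_prefix x y z].
Definition meet x y : K := xget 1 [set z | is_meet is_prefix x y z].

Definition compl d x : K := xget 1 [set y | Div d y /\ x * y = d].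

Definition left_normal d x y :=
  [/\ x <> 1, y <> 1 & meet (compl d x) y = 1].

End Garside.

Section ZappaSzep.
Variable K : monoidType.
Implicit Types (A B G H : set K) (a b d k : K).

Definition unique_factorization A B :=
  forall k, exists! p : K * K, [/\ A p.1, B p.2 & p.1 * p.2 = k].

(* Asking for the pairs (g1, h1) and (h2, g2) to be unique separately is the
   same as asking for the quadruple to be unique. *)
Definition zappa_szep G H :=
  [/\ monoid_closed (mem G), monoid_closed (mem H),
      unique_factorization G H & unique_factorization H G].

Definition zs_garside_structure G H dK dG dH :=
  [/\ garside_monoid [set: K], garside_structure [set: K] dK,
      garside_structure G dG, garside_structure H dH & dK = dG * dH].

(* For K the Zappa-Szep product of G and H, [act G H h g] is the element of G
   obtained by letting h act on g in the factorization of h * g over G and H,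
   and [act H G g h] is the element of H obtained by letting g act on h in the
   factorization of g * h over H and G; [act_inv A B b] is the inverse of the
   map [act A B b] on A. *)
Definition act A B b a : K :=
  xget 1 [set a' | A a' /\ exists2 b', B b' & b * a = a' * b'].

Definition act_inv A B b a : K := xget 1 [set x | A x /\ act A B b x = a].

End ZappaSzep.

(* Main.v *)
Require Import Defs.
From mathcomp Require Import all_boot.
From mathcomp Require Import boolp classical_sets cardinality.

Set Implicit Arguments.
Unset Strict Implicit.
Unset Printing Implicit Defensive.

Local Open Scope classical_set_scope.
Local Open Scope group_scope.

(** In K, a join of g in G and h in H has the form h x = g y with x in G and y
in H, and every common multiple of g and h of this form is the join; hence x
and y are the inverse actions of h on g and of g on h. Since submonoids G and H
are closed under factors, dK = dG dH = dH dG, which makes the situation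
symmetric in G and H. If d is the complement of h x in dK, then the G-component
of d is the complement of x in dG. A meet in K is trivial iff it has neither a
nontrivial prefix in G nor one in H, and the prefixes in G of d and of g2 \/ h2
are those of the G-component of d and of g2. *)

(** * Meets, joins and complements in a single Garside structure *)

Section Garside.
Variables (K : monoidType) (M : set K) (d : K).
Hypothesis gsM : garside_structure M d.
Implicit Types a b k u v w x y : K.

Lemma prefix_antisym x y :
  M x -> M y -> is_prefix M x y -> is_prefix M y x -> x = y.
Proof. by case: gsM => [[_ _ [_ + _ _] _] _]; apply. Qed.

Lemma join_uniq x y z : M x -> M y -> is_join M (is_prefix M) x y z ->
  join M x y = z.
Proof.
move=> Mx My jz; apply: xget_unique => // t [Mt xt yt tmin].
case: jz => Mz xz yz zmin.
by apply: prefix_antisym => //; [apply: tmin|apply: zmin].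
Qed.

Lemma joinP x y : M x -> M y -> is_join M (is_prefix M) x y (join M x y).
Proof.
case: gsM => [[_ _ [_ _ _ lat] _] _] Mx My.
by case: (lat x y Mx My) => + _; apply: xgetPex.
Qed.

Lemma meetP x y : M x -> M y -> is_meet M (is_prefix M) x y (meet M x y).
Proof.
case: gsM => [[_ _ [_ _ _ lat] _] _] Mx My.
by case: (lat x y Mx My) => _; apply: xgetPex.
Qed.

Lemma meet_eq1 x y : M 1 -> M x -> M y ->
  (meet M x y = 1 <->
   forall p, M p -> is_prefix M p x -> is_prefix M p y -> p = 1).
Proof.
move=> M1 Mx My; case: (meetP Mx My) => Mm mx my mmax; split=> [m1 p Mp px py|].
  apply: prefix_antisym => //; first by rewrite -m1; apply: mmax.
  by exists p => //; rewrite mul1g.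
by apply.
Qed.

Lemma mulM_eq1 u v : M 1 -> M u -> M v -> u * v = 1 -> u = 1.
Proof.
move=> M1 Mu Mv uv; apply: prefix_antisym => //; first by exists v.
by exists u => //; rewrite mul1g.
Qed.

Lemma Div_suffixE x : Div M d x <-> M x /\ is_suffix M x d.
Proof. by case: gsM => [_ [_ bal _ _]]; rewrite /Div bal. Qed.

Lemma compl_eq x y : M x -> M y -> x * y = d -> compl M d x = y.
Proof.
move=> Mx My xy; apply: xget_unique.
  by split=> //; apply/Div_suffixE; split=> //; exists x.
move=> t [[Mt _]]; rewrite -xy.
by case: gsM => [[+ _ _ _] _] => /(_ x t y Mx Mt My)[+ _]; apply.
Qed.

(** The complement of 1 is [d] itself, whose meet with its divisor [x] is [x]. This is what shows
    that the left letters of the normal forms are nontrivial. *)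
Lemma meet_compl1_eq1 x : M 1 -> Div M d x ->
  meet M (compl M d 1) x = 1 -> x = 1.
Proof.
have [_ [Md _ _ _]] := gsM; move=> M1 [Mx [u Mu dE]].
rewrite (compl_eq M1 Md (mul1g d)) => /(meet_eq1 M1 Md Mx); apply=> //.
  by exists u.
by exists 1; rewrite ?mulg1.
Qed.

Lemma joinC x y : M x -> M y -> join M x y = join M y x.
Proof.
move=> Mx My; case: (joinP My Mx) => Mj yj xj jmin.
by apply: join_uniq => //; split=> // w Mw xw yw; apply: jmin.
Qed.

End Garside.

(** * Consequences of unique factorization alone *)

Lemma zappa_szepC (K : monoidType) (A B : set K) :
  zappa_szep A B -> zappa_szep B A.
Proof. by case. Qed.

Section ZappaSzepFactorization.
Variables (K : monoidType) (A B : set K).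
Hypothesis zs : zappa_szep A B.
Implicit Types a b k u v w x y p q : K.

Lemma zs1A : A 1. Proof. by case: zs => -[/set_mem]. Qed.
Lemma zs1B : B 1. Proof. by case: zs => _ -[/set_mem]. Qed.

Lemma zsMA x y : A x -> A y -> A (x * y).
Proof.
case: zs => -[_ mulA] _ _ _ Ax Ay.
by apply/set_mem/mulA; apply: mem_set.
Qed.

Lemma zs_factor k : exists a b, [/\ A a, B b & k = a * b].
Proof.
by case: zs => _ _ /(_ k)[[a b] /= [[Aa Bb <-] _]] _; exists a, b.
Qed.

Lemma zs_factor_uniq a b a' b' : A a -> B b -> A a' -> B b' ->
  a * b = a' * b' -> a = a' /\ b = b'.
Proof.
move=> Aa Bb Aa' Bb' e.
case: zs => _ _ /(_ (a * b))[p [_ puniq]] _.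
have := puniq (a, b) (And3 Aa Bb (erefl _)).
have := puniq (a', b') (And3 Aa' Bb' (esym e)).
by move=> -> [].
Qed.

Lemma zs_capAB x : A x -> B x -> x = 1.
Proof.
move=> Ax Bx.
have [] := zs_factor_uniq Ax zs1B zs1A Bx; last by [].
by rewrite mulg1 mul1g.
Qed.

(** Factoring [u] over [A] and [B] lets [a] be absorbed into the [A]-component, which uniqueness
    identifies with [x]. *)
Lemma zs_prefixA a x y u : A x -> B y -> A a -> x * y = a * u ->
  exists2 v, A v & x = a * v /\ u = v * y.
Proof.
move=> Ax By Aa e.
have [v [w [Av Bw uE]]] := zs_factor u.
have e' : x * y = (a * v) * w by rewrite e uE mulgA.
have [xE yE] := zs_factor_uniq Ax By (zsMA Aa Av) Bw e'.
by exists v => //; rewrite uE yE.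
Qed.

End ZappaSzepFactorization.

(** * Divisors, Garside elements and joins in the product *)

Section ZappaSzep.
Variables (K : monoidType) (A B : set K) (dK dA dB : K).
Hypotheses (zs : zappa_szep A B) (gs : zs_garside_structure A B dK dA dB).
Implicit Types a b k u v w x y p q : K.

Let gsK : garside_structure [set: K] dK. Proof. by case: gs. Qed.
Let gsA : garside_structure A dA. Proof. by case: gs. Qed.
Let gsB : garside_structure B dB. Proof. by case: gs. Qed.
Let dKE : dK = dA * dB. Proof. by case: gs. Qed.

Lemma zs_mulI x y z : x * y = x * z -> y = z.
Proof. by case: gsK => [[+ _ _ _] _] e => /(_ x y z I I I)[+ _]; apply. Qed.

Lemma zs_mul_eq1 u v : u * v = 1 -> u = 1 /\ v = 1.
Proof.
move=> uv; have u1 : u = 1 by apply: (mulM_eq1 gsK) uv.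
by split=> //; rewrite -uv u1 mul1g.
Qed.

(* With u = a1 b1 and v = b2 a2, uniqueness in A B of u v = a1 (b1 b2 a2) puts
b1 b2 a2 in A; uniqueness in B A then gives b1 b2 = 1. *)
Lemma zs_divA u v : A (u * v) -> A u /\ A v.
Proof.
move=> Auv.
have [a1 [b1 [Aa1 Bb1 uE]]] := zs_factor zs u.
have [b2 [a2 [Bb2 Aa2 vE]]] := zs_factor (zappa_szepC zs) v.
have [a4 [b4 [Aa4 Bb4 bE]]] := zs_factor zs (b1 * b2 * a2).
have Bb := zsMA (zappa_szepC zs) Bb1 Bb2.
have e : (a1 * a4) * b4 = (u * v) * 1.
  by rewrite mulg1 -mulgA -bE uE vE !mulgA.
have [_ b41] := zs_factor_uniq zs (zsMA zs Aa1 Aa4) Bb4 Auv (zs1B zs) e.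
have e' : (b1 * b2) * a2 = 1 * a4 by rewrite bE b41 mul1g mulg1.
have [/zs_mul_eq1[b11 b21] _] :=
  zs_factor_uniq (zappa_szepC zs) Bb Aa2 (zs1B zs) Aa4 e'.
by rewrite uE vE b11 b21 mulg1 mul1g.
Qed.

(** Since [dK] is balanced, its suffix [v * w] is also a prefix. *)
Lemma dK_factor u v w : u * v * w = dK -> exists t, v * t = dK.
Proof.
move=> e; have : Div [set: K] dK (v * w).
  by apply/(Div_suffixE gsK); split=> //; exists u; rewrite // mulgA.
by case=> _ [t _ ->]; exists (w * t); rewrite mulgA.
Qed.

Lemma dK_prefixA a u : A a -> a * u = dK -> exists2 v, A v & dA = a * v.
Proof.
move=> Aa; rewrite dKE => /esym e.
have [_ [AdA _ _ _]] := gsA; have [_ [BdB _ _ _]] := gsB.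
by have [v Av [vE _]] := zs_prefixA zs AdA BdB Aa e; exists v.
Qed.

(** The suffix [dB] of the balanced [dK] is a prefix, so [dK = dB * b * a] with [b] in [B] and [a]
    in [A]. Balancedness of [dB] forces [b = 1], and that of [dA] forces [a = dA]. *)
Lemma dK_comm : dK = dB * dA.
Proof.
have [_ [AdA _ _ _]] := gsA; have [_ [BdB _ _ _]] := gsB.
have : Div [set: K] dK dB.
  by apply/(Div_suffixE gsK); split=> //; exists dA.
case=> _ [u _ dKu].
have [b [a [Bb Aa uE]]] := zs_factor (zappa_szepC zs) u.
(* The prefix [dB * b] of [dK] is also a suffix; comparing factorizations over [A] and [B] gives
   [dB = b' * dB * b]. So [dB * b] is a suffix, hence a prefix, of [dB], and [dB] cancels. *)
have b1 : b = 1.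
  have : Div [set: K] dK (dB * b).
    by split=> //; exists a; rewrite // dKu uE mulgA.
  case/(Div_suffixE gsK)=> _ [t _ tE].
  have [a' [b' [Aa' Bb' bE]]] := zs_factor zs t.
  have Bb2 := zsMA (zappa_szepC zs) Bb' (zsMA (zappa_szepC zs) BdB Bb).
  have e : dA * dB = a' * (b' * (dB * b)) by rewrite -dKE tE bE !mulgA.
  have [_ dBE] := zs_factor_uniq zs AdA BdB Aa' Bb2 e.
  have : Div B dB (dB * b).
    apply/(Div_suffixE gsB).
    by split; [apply: (zsMA (zappa_szepC zs))|exists b'].
  case=> _ [v _]; rewrite -mulgA -[LHS]mulg1 => /zs_mulI/esym.
  by case/zs_mul_eq1.
have {b b1 Bb uE} dKa : dK = dB * a by rewrite dKu uE b1 mul1g.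
have [w Aw dAE] : exists2 w, A w & dA = a * w.
  have : Div [set: K] dK a by apply/(Div_suffixE gsK); split=> //; exists dB.
  by case=> _ [v _ /esym]; apply: dK_prefixA.
have [t At aE] : exists2 t, A t & a = t * dA.
  have : Div [set: K] dK dA by split=> //; exists dB.
  case/(Div_suffixE gsK) => _ [t _ tE].
  have [b' [a' [Bb' Aa' bE]]] := zs_factor (zappa_szepC zs) t.
  have e : dB * a = b' * (a' * dA) by rewrite -dKa tE bE !mulgA.
  have [_ aE] := zs_factor_uniq (zappa_szepC zs) BdB Aa Bb' (zsMA zs Aa' AdA) e.
  by exists a'.
(* Here [t * (dA * w) = a * w = dA], so [dA * w] is a suffix of [dA]; as a prefix of [dA] it forces
   [w = 1]. *)
have : Div A dA (dA * w).
  apply/(Div_suffixE gsA).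
  by split; [apply: (zsMA zs)|exists t; rewrite // mulgA -aE].
case=> _ [v _]; rewrite -mulgA -[LHS]mulg1 => /zs_mulI/esym/zs_mul_eq1[w1 _].
by rewrite dKa dAE w1 mulg1.
Qed.

(* Write z = a (y a') with y in B, a' in A: already a y is a common multiple of
a and b, so a' = 1. *)
Lemma join_cofactor a b z : A a -> B b ->
  is_join [set: K] (is_prefix [set: K]) a b z -> exists2 y, B y & z = a * y.
Proof.
move=> Aa Bb [_ [u _ zu] [v _ zv] zmin].
have [y [a' [By Aa' uE]]] := zs_factor (zappa_szepC zs) u.
have [b1 [a1 [Bb1 Aa1 ayE]]] := zs_factor (zappa_szepC zs) (a * y).
have e : b1 * (a1 * a') = b * v by rewrite mulgA -ayE -mulgA -uE -zu.
have [w _ [b1E _]] := zs_prefixA (zappa_szepC zs) Bb1 (zsMA zs Aa1 Aa') Bb e.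
have [||t _] := zmin (a * y) I.
- by exists y.
- by exists (w * a1); rewrite // mulgA -b1E.
rewrite zu uE -2!mulgA => /zs_mulI; rewrite -[LHS]mulg1 => /zs_mulI/esym.
by case/zs_mul_eq1=> a'1 _; exists y; rewrite // a'1 mulg1.
Qed.

End ZappaSzep.

Lemma zs_garside_structureC (K : monoidType) (A B : set K) (dK dA dB : K) :
  zappa_szep A B -> zs_garside_structure A B dK dA dB ->
  zs_garside_structure B A dK dB dA.
Proof. by move=> zs gs; have := dK_comm zs gs; case: gs. Qed.

(** * Inverse actions, read off from joins *)

Section ZappaSzepAction.
Variables (K : monoidType) (A B : set K) (dK dA dB : K).
Hypotheses (zs : zappa_szep A B) (gs : zs_garside_structure A B dK dA dB).
Implicit Types a b k u v w x y p q : K.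

Let zsC := zappa_szepC zs.
Let gsC := zs_garside_structureC zs gs.
Let gsK : garside_structure [set: K] dK. Proof. by case: gs. Qed.
Let gsA : garside_structure A dA. Proof. by case: gs. Qed.
Let dKE : dK = dA * dB. Proof. by case: gs. Qed.

Lemma actE a b x y : A a -> A x -> B b -> B y -> b * x = a * y ->
  act A B b x = a.
Proof.
move=> Aa Ax Bb By e; apply: xget_unique; first by split=> //; exists y.
move=> a' [Aa' [b' Bb']]; rewrite e => e'.
by case: (zs_factor_uniq zs Aa By Aa' Bb' e').
Qed.

Lemma join_factors a b : A a -> B b ->
  exists x y, [/\ A x, B y, join [set: K] a b = b * x
                & join [set: K] a b = a * y].
Proof.
move=> Aa Bb.
have [y By jy] := join_cofactor zs gs Aa Bb (joinP gsK (x := a) (y := b) I I).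
have [x Ax jx] := join_cofactor zsC gsC Bb Aa (joinP gsK (x := b) (y := a) I I).
by exists x, y; split=> //; rewrite (joinC gsK).
Qed.

(** The join provides a preimage [x] of [a]. Any other preimage [x'] makes [b * x'] a common
    multiple, so [x' = x * w] with [w] in both [A] and [B] by closure under factors, whence
    [w = 1]. *)
Lemma act_invP a b : A a -> B b ->
  A (act_inv A B b a) /\ join [set: K] a b = b * act_inv A B b a.
Proof.
move=> Aa Bb; have [x [y [Ax By jx jy]]] := join_factors Aa Bb.
suff -> : act_inv A B b a = x by [].
apply: xget_unique; first by split=> //; apply: (actE (y := y)); rewrite // -jx.
move=> x' [Ax' actx'].
have [a' [y' [Aa' By' e]]] := zs_factor zs (b * x').
rewrite (actE Aa' Ax' Bb By' e) in actx'; rewrite {a' Aa'}actx' in e.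
have [_ _ _ /(_ (b * x') I)[||w _]] := joinP gsK (x := a) (y := b) I I.
- by exists y'.
- by exists x'.
move=> bx'E.
have x'E : x' = x * w by apply: (zs_mulI gs (x := b)); rewrite bx'E jx mulgA.
have y'E : y' = y * w by apply: (zs_mulI gs (x := a)); rewrite -e bx'E jy mulgA.
have [_ Aw] : A x /\ A w by apply: (zs_divA zs gs); rewrite -x'E.
have [_ Bw] : B y /\ B w by apply: (zs_divA zsC gsC); rewrite -y'E.
by rewrite x'E (zs_capAB zs Aw Bw) mulg1.
Qed.

Lemma join_prefix_dK a b :
  is_prefix [set: K] a dK -> is_prefix [set: K] b dK ->
  exists d, join [set: K] a b * d = dK.
Proof.
move=> adK bdK.
have [_ _ _ /(_ dK I adK bdK)[d _]] := joinP gsK (x := a) (y := b) I I.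
by move=> ->; exists d.
Qed.

Lemma Div_prefix_dK a : Div A dA a -> is_prefix [set: K] a dK.
Proof. by case=> _ [v _ e]; exists (v * dB) => //; rewrite dKE e mulgA. Qed.

(* With dB = b c, cancelling b in b x p q = dK = dB dA gives x p q = c dA.  As
the join of c and dA divides dK, it divides c dA, so dA is a prefix of x p q
and hence of x p. *)
Lemma act_inv_compl a b d p q : A a -> Div B dB b ->
  join [set: K] a b * d = dK -> A p -> B q -> d = p * q ->
  act_inv A B b a * p = dA.
Proof.
move=> Aa [Bb [c Bc dBE]] jd Ap Bq dE.
have [_ [AdA _ _ _]] := gsA.
have dKC := dK_comm zs gs.
have [Ax jx] := act_invP Aa Bb; set x := act_inv A B b a in Ax jx *.
have bxpq : b * (x * p) * q = dK by rewrite -jd jx dE !mulgA.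
have [t xpt] := dK_factor gs bxpq.
have Axp := zsMA zs Ax Ap.
have [v _ dAE] := dK_prefixA zs gs Axp xpt.
have xpq : x * p * q = c * dA.
  by apply: (zs_mulI gs (x := b)); rewrite !mulgA -dBE -dKC -bxpq !mulgA.
have [s cs] : exists s, c * s = dK.
  by apply: (dK_factor gs (u := b) (w := dA)); rewrite -dBE -dKC.
have [||r jr] := @join_prefix_dK dA c; [by exists dB|by exists s|].
have [x' [y' [Ax' By' jx' jy']]] := join_factors AdA Bc.
(* The join of [dA] and [c] is [c * x']; as a factor of [dK] lying in [A], [x'] is a prefix of [dA],
   so the join is a prefix of [c * dA]. *)
have [s' x's'] : exists s', x' * s' = dK.
  by apply: (dK_factor gs (u := c) (w := r)); rewrite -jx'.
have [w _ dAE'] := dK_prefixA zs gs Ax' x's'.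
have e : x * p * q = dA * (y' * w).
  by rewrite xpq dAE' mulgA -jx' jy' -dAE' !mulgA.
have [v' _ [xpE _]] := zs_prefixA zs Axp Bq AdA e.
(* Now [x * p] and [dA] are prefixes of each other. *)
have : dA * 1 = dA * (v' * v) by rewrite mulgA -xpE -dAE mulg1.
by move/(zs_mulI gs)/esym/(zs_mul_eq1 gs) => [v'1 _]; rewrite xpE v'1 mulg1.
Qed.

(** One half of the criterion: it controls the common prefixes lying in [A]. Exchanging [A] and [B]
    with the same [d] gives the other half. *)
Lemma meet_act_inv_eq1 a1 a2 b1 b2 d :
  A a1 -> A a2 -> Div B dB b1 -> B b2 -> join [set: K] a1 b1 * d = dK ->
  (meet A (compl A dA (act_inv A B b1 a1)) a2 = 1 <->
   forall k, A k -> is_prefix [set: K] k d ->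
     is_prefix [set: K] k (join [set: K] a2 b2) -> k = 1).
Proof.
move=> Aa1 Aa2 Db1 Bb2 jd.
have [p [q [Ap Bq dE]]] := zs_factor zs d.
have [Ax _] := act_invP Aa1 (proj1 Db1).
have [_ [y [_ By _ jy]]] := join_factors Aa2 Bb2.
have -> := compl_eq gsA Ax Ap (act_inv_compl Aa1 Db1 jd Ap Bq dE).
have prefE u v k : A u -> B v -> A k ->
    is_prefix A k u <-> is_prefix [set: K] k (u * v).
  move=> Au Bv Ak; split=> [[w _ ->]|[w _ e]].
    by exists (w * v); rewrite // mulgA.
  by have [w' Aw' [-> _]] := zs_prefixA zs Au Bv Ak e; exists w'.
rewrite (meet_eq1 gsA (zs1A zs) Ap Aa2) dE jy.
split=> triv k Ak.
  by rewrite -(prefE p q) // -(prefE a2 y) //; apply: triv.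
by rewrite (prefE p q) // (prefE a2 y) //; apply: triv.
Qed.

End ZappaSzepAction.

Theorem proposition47 (K : monoidType) (G H : set K) (dK dG dH : K)
  (zsK : zappa_szep G H) (zsD : zs_garside_structure G H dK dG dH)
  (g1 g2 h1 h2 : K)
  (Dg1 : Div G dG g1) (Dg2 : Div G dG g2)
  (Dh1 : Div H dH h1) (Dh2 : Div H dH h2) :
  (meet [set: K] (compl [set: K] dK (join [set: K] g1 h1))
                 (join [set: K] g2 h2) = 1 <->
   meet G (compl G dG (act_inv G H h1 g1)) g2 = 1 /\
   meet H (compl H dH (act_inv H G g1 h1)) h2 = 1) /\
  (g2 <> 1 -> h2 <> 1 ->
   (left_normal [set: K] dK (join [set: K] g1 h1) (join [set: K] g2 h2) <->
    left_normal G dG (act_inv G H h1 g1) g2 /\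
    left_normal H dH (act_inv H G g1 h1) h2)).
Proof.
have zsC := zappa_szepC zsK; have gsC := zs_garside_structureC zsK zsD.
have [_ gsK gsG gsH _] := zsD.
have [Gg1 _] := Dg1; have [Gg2 _] := Dg2.
have [Hh1 _] := Dh1; have [Hh2 _] := Dh2.
have jC g h : join [set: K] h g = join [set: K] g h by apply: (joinC gsK).
have [_ jx] := act_invP zsK zsD Gg1 Hh1.
have [d jd] :=
  join_prefix_dK zsD (Div_prefix_dK zsD Dg1) (Div_prefix_dK gsC Dh1).
have meetE : meet [set: K] (compl [set: K] dK (join [set: K] g1 h1))
      (join [set: K] g2 h2) = 1 <->
    meet G (compl G dG (act_inv G H h1 g1)) g2 = 1 /\
    meet H (compl H dH (act_inv H G g1 h1)) h2 = 1.
  rewrite (meet_act_inv_eq1 zsK zsD Gg1 Gg2 Dh1 Hh2 jd).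
  have jd' : join [set: K] h1 g1 * d = dK by rewrite jC.
  rewrite (meet_act_inv_eq1 zsC gsC Hh1 Hh2 Dg1 Gg2 jd') (jC g2 h2).
  rewrite (compl_eq gsK I I jd) (meet_eq1 gsK) //.
  split=> [triv|[trivG trivH] k _ [u _ dE] [v _ jE]].
    by split=> k _; apply: triv.
  (* The component [g] of a common prefix [k] is itself a common prefix, hence trivial; then [k = h]
     lies in [H]. *)
  have [g [h [Gg Hh kE]]] := zs_factor zsK k.
  have g1E : g = 1.
    apply: trivG => //; first by exists (h * u); rewrite // dE kE mulgA.
    by exists (h * v); rewrite // jE kE mulgA.
  move: kE; rewrite g1E mul1g => kE.
  by rewrite kE; apply: trivH => //; rewrite -kE; [exists u|exists v].
split=> // g2N1 h2N1.
have [_ [u _ j2E] _ _] := joinP gsK (x := g2) (y := h2) I I.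
split=> [[_ _ /meetE[mG mH]]|[[xN1 _ mG] [_ _ mH]]]; last first.
  (* The joins are nontrivial because one has the nontrivial right factor [act_inv G H h1 g1] and
     the other the prefix [g2]. *)
  split; last exact/meetE.
    by rewrite jx => /(zs_mul_eq1 zsD)[].
  by rewrite j2E => /(zs_mul_eq1 zsD)[].
(* If an inverse action gave 1, its complement would be the whole Garside element, and a trivial
   meet would force [g2 = 1] or [h2 = 1]. *)
split; split=> // x1.
  by rewrite x1 in mG; apply/g2N1/(meet_compl1_eq1 gsG (zs1A zsK) Dg2).
by rewrite x1 in mH; apply/h2N1/(meet_compl1_eq1 gsH (zs1B zsK) Dh2).
Qed.
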